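(* Let $H:\mathbb{R}_+\to\mathbb{R}$ be nonincreasing and not identically equal to zero, with $$\lim_{r\to\infty}r^{d-1}H(r)=0.$$ Suppose that $G:\mathbb{R}_+\times\mathbb{R}_+\to\mathbb{R}$ is a Borel measurable function satisfying $G(s,0)=G(0,t)=0$ for all $s,t\ge0$. If for all nonnegative finitely supported functions $u,v$ on $\mathbb{Z}^d$ $$\sum_{x,y\in\mathbb{Z}^d}G(u(x),v(y))H(d(x,y))\le\sum_{x,y\in\mathbb{Z}^d}G(u^*(x),v^*(y))H(d(x,y)),$$ where $u^*=R_{\mathbb{Z}^d}u$ and $v^*=R_{\mathbb{Z}^d}v$, then $G$ is supermodular.
   Context: $\mathbb{R}_+=[0,\infty)$, $d\ge1$ is an integer, $e_i$ is the $i$-th standard unit vector, $\langle\cdot,\cdot\rangle$ the Euclidean inner product. On $\mathbb{Z}^d$, $d(x,y)=\sum_{i=1}^d|x^i-y^i|$ is the graph distance of the lattice graph. Supermodular: $G(s+s_0,t+t_0)+G(s,t)\ge G(s,t+t_0)+G(s+s_0,t)$ for all $s,t,s_0,t_0\ge0$. Admissible functions: $u\in C_0^+(\mathbb{Z}^d)$ means $u:\mathbb{Z}^d\to\mathbb{R}_+$ with $\{u>t\}$ finite for all $t>0$ (similarly on $\mathbb{Z}$ or $\mathbb{Z}+1/2$). One-dimensional rearrangement: for $w$ admissible on $\mathbb{Z}$ or on $\mathbb{Z}+1/2$ with $n$-th largest values $a_1\ge a_2\ge\cdots$ (with multiplicity), $R_{\mathbb{Z}}w(x)=a_{1-2x}$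 if $x\le0$ and $R_{\mathbb{Z}}w(x)=a_{2x}$ if $x>0$. Rearrangement on $\mathbb{Z}^d$: let $\vec E=\{e_i,\frac{e_i+e_j}{2},\frac{e_i-e_j}{2}:1\le i<j\le d\}$ (all $e_i$, $1\le i\le d$, included). For $e\in\vec E$, partition $\mathbb{Z}^d$ into the classes of the relation ''$x-y$ is parallel to $e$''; on each class $V$ the map $x\mapsto\langle e,x\rangle$ is a bijection onto $\mathbb{Z}$ or $\mathbb{Z}+1/2$, and the one-step rearrangement $R_eu$ is defined by $(R_eu)|_V=R_{\mathbb{Z}}(u|_V)$ under this identification. Fix an enumeration of $\vec E$ (for $d=2$: $e_1,e_2,\frac{e_1+e_2}{2},\frac{e_1-e_2}{2}$); $R^ku$ is obtained from $u$ by applying successively the first $k$ of the operators $R_e$ in the sequence obtained by repeating this enumeration cyclically. The Schwarz rearrangement is $R_{\mathbb{Z}^d}u(x)=\lim_{k\to\infty}R^ku(x)$, $x\in\mathbb{Z}^d$ (the limit exists). *)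

(* Defs.v *)
From HB Require Import structures.
From mathcomp Require Import all_boot all_order all_algebra.
From mathcomp Require Import all_classical all_reals all_analysis.
Set Implicit Arguments.
Unset Strict Implicit.
Unset Printing Implicit Defensive.
Import Order.TTheory GRing.Theory Num.Theory.
Import numFieldNormedType.Exports.
Local Open Scope classical_set_scope.
Local Open Scope ring_scope.

(* Functions on [0, +oo[ are represented by functions on R that are only
   constrained on nonnegative arguments; the lattice Z^d is 'rV[int]_d. *)

Definition supermodular (R : realType) (G : R -> R -> R) : Prop :=
  forall s t s0 t0 : R, 0 <= s -> 0 <= t -> 0 <= s0 -> 0 <= t0 ->
    G s (t + t0) + G (s + s0) t <= G (s + s0) (t + t0) + G s t.

Definition lattice_dist (d : nat) (x y : 'rV[int]_d) : nat :=
  (\sum_(i < d) absz (x ord0 i - y ord0 i)%R)%N.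

Definition fin_supp_nonneg (R : realType) (d : nat) (u : 'rV[int]_d -> R) :
    Prop :=
  (forall x, 0 <= u x) /\ finite_set [set x | u x != 0].

(* The n-th largest value (n >= 1, counted with multiplicity) of w on V: the
   largest t such that w >= t at n or more points of V. If w is nonnegative,
   V is infinite and the sets {w > t}, t > 0, are finite, then the supremum is
   attained. *)
Definition nth_largest (R : realType) (T : Type) (V : set T) (w : T -> R)
    (n : nat) : R :=
  sup [set t : R | (`I_n #<= V `&` [set x | (t <= w x)%R])%card].

(* For p in Z or Z + 1/2, the rational below is a positive integer, so that
   truncation only changes its type. *)
Definition slot (p : rat) : nat :=
  Num.truncn (if p <= 0 then 1 - 2 * p else 2 * p).

(* The one-dimensional rearrangement, carried over to V by a bijection pos from
   V onto Z or Z + 1/2; values of w and pos outside V do not matter. *)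
Definition rearrange1 (R : realType) (T : Type) (V : set T) (pos : T -> rat)
    (w : T -> R) (x : T) : R :=
  nth_largest V w (slot (pos x)).

Definition directions (d : nat) : set 'rV[rat]_d :=
  [set e | (exists i : 'I_d, e = delta_mx ord0 i) \/
           (exists i j : 'I_d, (i < j)%N /\
             (e = 2^-1 *: (delta_mx ord0 i + delta_mx ord0 j) \/
              e = 2^-1 *: (delta_mx ord0 i - delta_mx ord0 j)))].

Definition is_enumeration (T : eqType) (es : seq T) (E : set T) : Prop :=
  uniq es /\ [set` es] = E.

Definition inner (d : nat) (e : 'rV[rat]_d) (x : 'rV[int]_d) : rat :=
  \sum_(i < d) e ord0 i * (x ord0 i)%:~R.

Definition parallel_class (d : nat) (e : 'rV[rat]_d) (x : 'rV[int]_d) :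
    set 'rV[int]_d :=
  [set y | exists c : rat, map_mx intr (x - y) = c *: e].

Definition rearrange_dir (R : realType) (d : nat) (e : 'rV[rat]_d)
    (u : 'rV[int]_d -> R) : 'rV[int]_d -> R :=
  fun x => rearrange1 (parallel_class e x) (inner e) u x.

Fixpoint rearrange_iter (R : realType) (d : nat) (es : seq 'rV[rat]_d)
    (k : nat) (u : 'rV[int]_d -> R) : 'rV[int]_d -> R :=
  if k is k'.+1 then
    rearrange_dir (nth 0 es (k' %% size es)) (rearrange_iter es k' u)
  else u.

Definition schwarz (R : realType) (d : nat) (es : seq 'rV[rat]_d)
    (u : 'rV[int]_d -> R) : 'rV[int]_d -> R :=
  fun x => limn (fun k => rearrange_iter es k u x).

(* The sum over all pairs. A sum over an infinite index set is the finite sum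
   over its support; for G vanishing on the axes and finitely supported u and v
   the support of the summand is finite. *)
Definition riesz_sum (R : realType) (d : nat) (G : R -> R -> R) (H : R -> R)
    (u v : 'rV[int]_d -> R) : R :=
  \sum_(p \in [set: 'rV[int]_d * 'rV[int]_d])
     G (u p.1) (v p.2) * H (lattice_dist p.1 p.2)%:R.

(* Main.v *)
Require Import Defs.
From HB Require Import structures.
From mathcomp Require Import all_boot all_order all_algebra.
From mathcomp Require Import all_classical all_reals all_analysis.
From mathcomp Require Import zify ring lra.
Set Implicit Arguments.
Unset Strict Implicit.
Unset Printing Implicit Defensive.
Import Order.TTheory GRing.Theory Num.Theory.
Import numFieldNormedType.Exports.
Local Open Scope classical_set_scope.
Local Open Scope ring_scope.

(** The hypothesis is tested on two functions that are almost constant on a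
    large box: [u] is [s] on the box [max |x_i| <= n], raised to [s + s0] at the
    origin, and [v] is [t] on the same box, raised to [t + t0] at a point [p].
    The box and the origin are symmetric under all the directions, hence [u] is
    its own Schwarz rearrangement; if [p] lies on the line through the origin
    along the first direction of the enumeration, then the first one-step
    rearrangement of [v] already moves the peak to the origin, and nothing
    changes afterwards ([schwarz_plateau]).

    Write [D] for the mixed difference
    [G (s + s0) (t + t0) - G (s + s0) t - G s (t + t0) + G s t],
    [g = G s (t + t0) - G s t], and [f p] for the sum of [H (d(x, p))] over the
    [x] in the box.  The two sides of the hypothesis differ only in the terms
    that see the peak of [v] ([riesz_sum_plateau]), which leaves
    [g * f p + D * H (d(p, 0)) <= g * f 0 + D * H 0].

    When the box grows, [f p - f 0] tends to 0: the box translated by [- p] and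
    the box itself differ only inside an annulus of bounded width, which has
    [O(n^(d-1))] points, and on it [H] is at most its value at distance about
    [n] ([box_sum_shift]); this is where the decay of [r^(d-1) * H r] enters.
    In the limit [D * (H 0 - H (d(p, 0))) >= 0].  As [H] decreases to 0
    without vanishing identically, [p] can be taken so far away that
    [H (d(p, 0)) < H 0] ([kernel_lt_origin]), and [D >= 0] follows. *)

(** * Order statistics on a countable set *)

(** A threshold at most [w p] keeps all the [rk p + 1] points of rank at most
    [rk p], and a threshold above [w p] keeps only points of smaller rank, of
    which there are [rk p]; hence the supremum is over the half-line of the
    thresholds up to [w p]. *)
Lemma nth_largest_rank (R : realType) (T : Type) (V : set T) (w : T -> R)
    (rk : T -> nat)
    (rk_inj : forall p q, V p -> V q -> rk p = rk q -> p = q)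
    (rk_surj : forall n, exists2 p, V p & rk p = n)
    (w_mono : forall p q, V p -> V q -> (rk p <= rk q)%N -> w q <= w p)
    (p : T) (Vp : V p) :
  nth_largest V w (rk p).+1 = w p.
Proof.
rewrite /nth_largest; set S := [set t | _].
suff -> : S = `]-oo, w p]%classic by rewrite sup_itv.
have [g Vg gK] : exists2 g : nat -> T, forall n, V (g n) & cancel g rk.
  have /choice[g gP] : forall n, exists p, V p /\ rk p = n.
    by move=> n; have [q] := rk_surj n; exists q.
  by exists g => n; case: (gP n).
apply/seteqP; split=> t /=; rewrite in_itv /=; last first.
  move=> t_le.
  have g_inj : {in `I_(rk p).+1 &, injective g}.
    by move=> m n _ _ /(congr1 rk); rewrite !gK.
  rewrite /S /= -(card_le_eql (inj_card_eq g_inj)).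
  apply: subset_card_le => _ [n /= n_lt <-]; split => //=.
  by apply: (le_trans t_le); apply: w_mono => //; rewrite gK.
rewrite leNgt => card_A; apply/negP => wp_lt.
suff : (`I_(rk p).+1 #<= `I_(rk p))%card by rewrite card_le_II ltnn.
apply: (card_le_trans card_A).
set A := V `&` _.
have rk_injA : {in A &, injective rk}.
  by move=> q q'; rewrite !inE => -[Vq _] [Vq' _]; apply: rk_inj.
rewrite -(card_le_eql (inj_card_eq rk_injA)).
apply: subset_card_le => _ [q [Vq /= t_le] <-] /=.
rewrite ltnNge; apply/negP => /(w_mono _ _ Vp Vq) wq_le.
by move: (lt_le_trans wp_lt t_le); rewrite ltNge wq_le.
Qed.

(** * Directions of the lattice *)

Lemma slot_half (z : int) :
  slot (z%:~R / 2) = absz (if z <= 0 then 1 - z else z).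
Proof.
rewrite /slot pmulr_lle0 ?invr_gt0 // lerz0.
have -> : 2 * (z%:~R / 2) = z%:~R :> rat by rewrite mulrC divfK.
case: ifP => z_le; last first.
  by rewrite -(natrK (R := rat) `|z|%N) natr_absz ger0_norm //; lia.
have -> : 1 - z%:~R = (1 - z)%:~R :> rat by rewrite intrD mulrNz.
by rewrite -(natrK (R := rat) `|1 - z|%N) natr_absz ger0_norm //; lia.
Qed.

Definition in_box (d n : nat) (x : 'rV[int]_d) : Prop :=
  forall i, (absz (x ord0 i) <= n)%N.

(** What the rearrangement along [e] uses of the geometry of [e]: [c] is the
    primitive lattice vector parallel to [e], and [z] is twice the position
    along [e], which makes it an integer of constant parity on each class.
    The condition on boxes says that on each line parallel to [e] a box is an
    interval of positions centred at 0. *)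
Record axis (d : nat) (e : 'rV[rat]_d) (c : 'rV[int]_d)
    (z : 'rV[int]_d -> int) : Prop := Axis {
  axis_inner : forall x, inner e x = (z x)%:~R / 2;
  axis_step : forall x (k : int), z (x + k *: c) = z x + 2 * k;
  axis_class : forall x y,
    parallel_class e x y <-> exists k : int, y = x + k *: c;
  axis_box : forall n x (k : int), `|z (x + k *: c)| <= `|z x| ->
    in_box n x -> in_box n (x + k *: c);
  axis_le1 : in_box 1 c;
  axis_eq1 : exists i, c ord0 i = 1 }.

(** Two lattice points differing by a rational multiple of [c] differ by an
    integer multiple, because [c] has a coordinate equal to 1. *)
Lemma parallel_class_scale (d : nat) (e : 'rV[rat]_d) (c : 'rV[int]_d)
    (a : rat) (i : 'I_d) (a0 : a != 0) (ci : c ord0 i = 1)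
    (ec : e = a *: map_mx intr c) (x y : 'rV[int]_d) :
  parallel_class e x y <-> exists k : int, y = x + k *: c.
Proof.
split=> [[q qP]|[k ->]]; last first.
  exists (- k%:~R / a); rewrite ec scalerA divfK //.
  by apply/rowP => j; rewrite !mxE -mulrNz -intrM; congr (_%:~R); ring.
pose k : int := (y - x) ord0 i; exists k.
have qk : q * a = - k%:~R.
  move/rowP/(_ i): qP; rewrite ec scalerA !mxE ci mulr1 => <-.
  by rewrite -mulrNz /k !mxE opprB.
apply/rowP => j; rewrite !mxE.
move/rowP/(_ j): qP; rewrite ec scalerA qk !mxE.
move=> /eqP; rewrite -mulrNz -intrM eqr_int => /eqP.
by move=> h; rewrite -[y _ _](subrK (x ord0 j)) -[y _ _ - _]opprB h; ring.
Qed.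

Lemma inner_delta (d : nat) (i : 'I_d) (x : 'rV[int]_d) :
  inner (delta_mx ord0 i) x = (x ord0 i)%:~R.
Proof.
rewrite /inner (bigD1 i) //= big1 => [|j ji]; rewrite mxE eqxx.
  by rewrite eqxx mul1r addr0.
by rewrite (negbTE ji) mul0r.
Qed.

Lemma axis_coordinate (d : nat) (i : 'I_d) :
  axis (delta_mx ord0 i) (delta_mx ord0 i) (fun x => 2 * x ord0 i).
Proof.
split=> [x|x k|x y|n x k|j|].
- by rewrite inner_delta intrM mulrC mulKf.
- by rewrite !mxE !eqxx /= mulr1; ring.
- apply: (@parallel_class_scale _ _ _ 1 i); rewrite ?oner_eq0 ?mxE ?eqxx //.
  by rewrite scale1r map_delta_mx.
- move=> le_z x_box j; move: le_z (x_box i) (x_box j).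
  by rewrite !mxE !eqxx /=; case: eqP => [->|_] /=; lia.
- by rewrite mxE eqxx /=; case: eqP.
- by exists i; rewrite mxE !eqxx.
Qed.

(** A box is symmetric along a diagonal because [max (|a|, |b|)] equals
    [(|a + b| + |a - b|) / 2], and one of the two terms is constant along the
    line. *)
Lemma axis_diagonal (d : nat) (i j : 'I_d) (s : int) :
  i != j -> s = 1 \/ s = -1 ->
  axis (2^-1 *: (delta_mx ord0 i + s%:~R *: delta_mx ord0 j))
    (delta_mx ord0 i + s *: delta_mx ord0 j)
    (fun x => x ord0 i + s * x ord0 j).
Proof.
move=> ij sE.
have ji : (j == i) = false by rewrite eq_sym; apply: negbTE.
split=> [x|x k|x y|n x k|l|].
- rewrite intrD intrM -!inner_delta /inner mulrDl mulrAC !mulr_suml mulr_sumr.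
  by rewrite -big_split /=; apply: eq_bigr => l _; rewrite !mxE; ring.
- rewrite !mxE !eqxx (negbTE ij) ji /= mulr0 mulr1.
  by case: sE => ->; ring.
- apply: (@parallel_class_scale _ _ _ 2^-1 i) => //.
    by rewrite !mxE !eqxx (negbTE ij) mulr0 addr0.
  by rewrite map_mxD map_mxZ !map_delta_mx.
- move=> le_z x_box l; move: le_z (x_box i) (x_box j) (x_box l).
  rewrite !mxE !eqxx (negbTE ij) ji /=.
  case: (eqVneq l i) => [->|li]; last case: (eqVneq l j) => [->|lj] /=;
    rewrite ?(negbTE ij) ?ji /=; case: sE => ->; lia.
- rewrite !mxE eqxx /=; case: (eqVneq l i) => [->|li];
    rewrite ?(negbTE ij) /=; last case: (eqVneq l j) => _;
    case: sE => ->; lia.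
- by exists i; rewrite !mxE !eqxx (negbTE ij) mulr0 addr0.
Qed.

Lemma directions_axis (d : nat) (e : 'rV[rat]_d) :
  directions e -> exists c z, axis e c z.
Proof.
case=> [[i ->]|[i [j [ij eE]]]].
  by do 2!eexists; apply: axis_coordinate.
have ne_ij : i != j by rewrite -val_eqE neq_ltn ij.
case: eE => ->.
  rewrite -[delta_mx ord0 j in X in axis X]scale1r.
  by do 2!eexists; apply: (@axis_diagonal _ i j 1) => //; left.
rewrite -[- delta_mx ord0 j in X in axis X]scaleN1r.
by do 2!eexists; apply: (@axis_diagonal _ i j (-1)) => //; right.
Qed.

(** * Rearrangement of a peaked plateau *)

(** The zero-based rank that the rearrangement gives to the position [a / 2].
    Among integers of one parity it is a bijection onto the natural numbers
    that orders them by absolute value. *)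
Definition int_rank (a : int) : nat := if a <= 0 then absz a else (absz a).-1.

Lemma slot_rank (a : int) : slot (a%:~R / 2) = (int_rank a).+1.
Proof. by rewrite slot_half /int_rank; case: ifP; lia. Qed.

Lemma int_rank_surj (a : int) (n : nat) :
  exists k : int, int_rank (a + 2 * k) = n.
Proof.
have [h] : exists h : int, a + n%:Z = 2 * h \/ a + n%:Z = 2 * h - 1.
  by exists ((a + n%:Z + 1) %/ 2)%Z; lia.
rewrite /int_rank => -[ha|ha].
  by exists (- h); case: ifP; lia.
by exists (n%:Z + 1 - h); case: ifP; lia.
Qed.

(** A function that decreases with the distance to the centre of each line is
    fixed by the rearrangement along that line.  The rearrangement depends only
    on the values on each line and not on their places, so permuting the points
    of every line beforehand is harmless. *)
Lemma rearrange_dir_swap (R : realType) (d : nat) (e : 'rV[rat]_d)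
    (c : 'rV[int]_d) (z : 'rV[int]_d -> int) (ax : axis e c z)
    (u : 'rV[int]_d -> R) (tau : 'rV[int]_d -> 'rV[int]_d)
    (tauK : involutive tau) (tau_class : forall x, parallel_class e x (tau x))
    (u_mono : forall x (k : int), `|z (x + k *: c)| <= `|z x| ->
       u x <= u (x + k *: c)) :
  rearrange_dir e (u \o tau) = u.
Proof.
apply/funext => x; rewrite /rearrange_dir /rearrange1.
(* The points are ranked by their image under [tau], along which [u \o tau]
   decreases. *)
pose rk p := int_rank (z (tau p)).
have classP := axis_class ax.
have tauE p : exists k : int, tau p = p + k *: c by apply/classP/tau_class.
have V_tau p : parallel_class e x p -> exists k : int, tau p = x + k *: c.
  by move=> /classP[k ->]; have [l ->] := tauE (x + k *: c);
     exists (k + l); rewrite scalerDl addrA.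
have Vtaux : parallel_class e x (tau x) by apply: tau_class.
have -> : slot (inner e x) = (rk (tau x)).+1.
  by rewrite /rk tauK (axis_inner ax) slot_rank.
rewrite nth_largest_rank //= ?tauK // => [p q Vp Vq|n|p q Vp Vq].
- rewrite /rk; have [k pE] := V_tau p Vp; have [l qE] := V_tau q Vq.
  rewrite pE qE !(axis_step ax) /int_rank => rE.
  apply: (can_inj tauK); rewrite pE qE; congr (_ + _ *: _).
  by move: rE; do 2 case: ifP; lia.
- have [k rE] := int_rank_surj (z x) n.
  exists (tau (x + k *: c)); last by rewrite /rk tauK (axis_step ax).
  apply/classP; have [l ->] := tauE (x + k *: c).
  by exists (k + l); rewrite scalerDl addrA.
- rewrite /rk /=; have [k ->] := V_tau p Vp; have [l ->] := V_tau q Vq.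
  have -> : x + k *: c = x + l *: c + (k - l) *: c.
    by rewrite -addrA -scalerDl; congr (_ + _ *: _); ring.
  move=> rk_le; apply: u_mono; move: rk_le.
  by rewrite !(axis_step ax) /int_rank; do 2 case: ifP; lia.
Qed.

Definition plateau (R : realType) (d n : nat) (a b : R)
    (p x : 'rV[int]_d) : R :=
  if `[< in_box n x >] then a + (if x == p then b else 0) else 0.

Lemma in_box0 (d n : nat) : in_box n (0 : 'rV[int]_d).
Proof. by move=> i; rewrite mxE. Qed.

Lemma plateau_mono (R : realType) (d n : nat) (a b : R) (a0 : 0 <= a)
    (b0 : 0 <= b) (e : 'rV[rat]_d) (c : 'rV[int]_d) (z : 'rV[int]_d -> int)
    (ax : axis e c z) (x : 'rV[int]_d) (k : int) :
  `|z (x + k *: c)| <= `|z x| ->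
  plateau n a b 0 x <= plateau n a b 0 (x + k *: c).
Proof.
move=> z_le; rewrite /plateau; case: asboolP => [x_box|_]; last first.
  by case: asboolP => // _; case: ifP; rewrite ?addr0 ?addr_ge0.
rewrite asboolT; last exact: (axis_box ax).
case: (eqVneq x 0) => [x0|_]; last by case: ifP; rewrite addr0 // lerDl.
move: z_le; rewrite x0 (axis_step ax) => z_le.
have z0 : z 0 = 0.
  have := axis_inner ax 0; rewrite /inner big1 => [|i _]; last first.
    by rewrite mxE mulr0.
  by move=> /esym/eqP; rewrite mulf_eq0 invr_eq0 orbF intr_eq0 => /eqP.
have -> : k = 0 by move: z_le; rewrite z0; lia.
by rewrite scale0r addr0 eqxx.
Qed.

Definition swap (T : eqType) (p q x : T) : T :=
  if x == p then q else if x == q then p else x.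

Lemma swapK (T : eqType) (p q : T) : involutive (swap p q).
Proof.
move=> x; rewrite /swap; have [->|xp] := eqVneq x p.
  by rewrite eqxx; case: eqP.
have [->|xq] := eqVneq x q; first by rewrite eqxx.
by rewrite (negbTE xp) (negbTE xq).
Qed.

Lemma plateau_swap (R : realType) (d n : nat) (a b : R) (p : 'rV[int]_d) :
  in_box n p -> plateau n a b p = plateau n a b 0 \o swap p 0.
Proof.
move=> p_box; apply/funext => x; rewrite /plateau /swap /=.
have [->|xp] := eqVneq x p; first by rewrite !asboolT ?eqxx //; exact: in_box0.
have [x0|x0] := eqVneq x 0; last by rewrite (negbTE x0).
subst x; have [p0|p0] := eqVneq p 0; first by move: xp; rewrite p0 eqxx.
by rewrite !asboolT //; exact: in_box0.
Qed.

Lemma rearrange_plateau (R : realType) (d n : nat) (a b : R) (a0 : 0 <= a)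
    (b0 : 0 <= b) (e : 'rV[rat]_d) (c : 'rV[int]_d) (z : 'rV[int]_d -> int)
    (ax : axis e c z) (k : int) :
  in_box n (k *: c) ->
  rearrange_dir e (plateau n a b (k *: c)) = plateau n a b 0.
Proof.
move=> p_box; rewrite plateau_swap //.
apply: (rearrange_dir_swap ax); [exact: swapK| |]; last first.
  by move=> y l; apply: (plateau_mono n a0 b0 ax).
move=> x; apply/(axis_class ax); rewrite /swap.
have [->|_] := eqVneq x (k *: c).
  by exists (- k); rewrite scaleNr subrr.
case: eqP => [->|_]; first by exists k; rewrite add0r.
by exists 0; rewrite scale0r addr0.
Qed.

(** With the peak on the line of the first direction, the sequence of iterated
    rearrangements is constant from its second term on. *)
Lemma schwarz_plateau (R : realType) (d n : nat) (es : seq 'rV[rat]_d)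
    (a b : R) (a0 : 0 <= a) (b0 : 0 <= b) (c : 'rV[int]_d)
    (z : 'rV[int]_d -> int) (k : int) :
  (0 < size es)%N -> (forall e, e \in es -> directions e) ->
  axis (nth 0 es 0) c z -> in_box n (k *: c) ->
  schwarz es (plateau n a b (k *: c)) = plateau n a b 0.
Proof.
move=> es_gt0 es_dir ax p_box; apply/funext => x; rewrite /schwarz.
apply: norm_lim_near_cst; exists 1%N => // j /=.
suff iterE i :
    rearrange_iter es i.+1 (plateau n a b (k *: c)) = plateau n a b 0.
  by case: j => [//|j] _; rewrite iterE.
elim: i => [|i IHi]; first by rewrite /= mod0n (rearrange_plateau _ _ ax).
rewrite -[RHS]/(plateau n a b 0) [LHS]/= -/(rearrange_iter es i.+1 _) IHi.
have [c' [z' ax']] : exists c' z', axis (nth 0 es (i.+1 %% size es)) c' z'.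
  by apply/directions_axis/es_dir/mem_nth; rewrite ltn_mod.
(* From here on the peak is at the origin, the multiple 0 of any [c']. *)
have := @rearrange_plateau R d n a b a0 b0 _ _ _ ax' 0.
by rewrite scale0r; apply; exact: in_box0.
Qed.

(** * Sums of the kernel over boxes *)

Lemma in_boxD (d m n : nat) (x y : 'rV[int]_d) :
  in_box m x -> in_box n y -> in_box (m + n) (x + y).
Proof.
move=> x_box y_box i; move: (x_box i) (y_box i).
by rewrite mxE; move: (x _ _) (y _ _) => a b; lia.
Qed.

Lemma in_boxB (d m n : nat) (x y : 'rV[int]_d) :
  in_box m x -> in_box n y -> in_box (m + n) (x - y).
Proof.
move=> x_box y_box i; move: (x_box i) (y_box i).
by rewrite !mxE; move: (x _ _) (y _ _) => a b; lia.
Qed.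

Definition box (d n : nat) : seq 'rV[int]_d :=
  [seq \row_i ((f i : nat)%:Z - n%:Z : int) | f : {ffun 'I_d -> 'I_(n.*2.+1)}].

Lemma mem_box (d n : nat) (x : 'rV[int]_d) :
  reflect (in_box n x) (x \in box d n).
Proof.
apply: (iffP mapP) => [[f _ ->] i|x_box].
  have := ltn_ord (f i); rewrite mxE => ?.
  by suff : (`|(f i)%:Z - n%:Z| <= n)%N by []; lia.
exists [ffun i => inord (absz (x ord0 i + n%:Z))]; first by rewrite mem_enum.
apply/rowP => i; rewrite mxE ffunE; have := x_box i.
move: (x ord0 i) => a a_le; rewrite inordK; last lia.
by suff : a = (absz (a + n%:Z)%R)%:Z - n%:Z by []; lia.
Qed.

Lemma box_uniq (d n : nat) : uniq (box d n).
Proof.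
rewrite map_inj_uniq ?enum_uniq // => f g /rowP fg; apply/ffunP => i.
by apply/val_inj; have := fg i; rewrite !mxE /=; lia.
Qed.

Lemma size_box (d n : nat) : size (box d n) = (n.*2.+1 ^ d)%N.
Proof. by rewrite size_map -cardE card_ffun !card_ord. Qed.

Lemma sum_sub_seq_bound (R : realDomainType) (T : eqType) (s1 s2 : seq T)
    (F : T -> R) (M : R) :
  uniq s1 -> uniq s2 -> {subset s1 <= s2} ->
  (forall x, x \in s2 -> x \notin s1 -> 0 <= F x <= M) ->
  0 <= \sum_(x <- s2) F x - \sum_(x <- s1) F x <=
    ((size s2)%:R - (size s1)%:R) * M.
Proof.
move=> u1 u2 s12 FM; pose s := [seq x <- s2 | x \notin s1].
have s2E : perm_eq s2 (s1 ++ s).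
  rewrite -(perm_filterC (mem s1) s2) perm_cat2r; apply: uniq_perm => //.
    exact: filter_uniq.
  by move=> x; rewrite mem_filter /= andb_idr //; apply: s12.
rewrite (perm_big _ s2E) (perm_size s2E) size_cat big_cat natrD /=.
rewrite !(addrC _ (\sum_(x <- s) _)) addrK (addrC (size s1)%:R) addrK.
have {}FM x : x \in s -> 0 <= F x <= M.
  by rewrite mem_filter => /andP[? ?]; apply: FM.
rewrite big_seq sumr_ge0 => [|x /FM/andP[]//] /=.
rewrite mulr_natl -iter_addr_0 -(count_predT s) -big_const_seq.
by rewrite [leRHS]big_seq; apply: ler_sum => x /FM/andP[].
Qed.

Lemma lattice_dist_sub (d : nat) (x p : 'rV[int]_d) :
  lattice_dist x p = lattice_dist (x - p) 0.
Proof. by apply: eq_bigr => i _; rewrite !mxE subr0. Qed.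

Lemma lattice_distC (d : nat) (x y : 'rV[int]_d) :
  lattice_dist x y = lattice_dist y x.
Proof. by apply: eq_bigr => i _; rewrite -abszN opprB. Qed.

Lemma ge_lattice_dist (d k : nat) (x : 'rV[int]_d) (i : 'I_d) :
  (k <= absz (x ord0 i))%N -> (k <= lattice_dist x 0)%N.
Proof.
move=> k_le; rewrite /lattice_dist (bigD1 i) //= mxE subr0.
exact: (leq_trans k_le (leq_addr _ _)).
Qed.

Lemma notin_box_dist (d k : nat) (x : 'rV[int]_d) :
  x \notin box d k -> (k <= lattice_dist x 0)%N.
Proof.
move/mem_box => x_box; rewrite leqNgt; apply/negP => lt_k; apply: x_box => i.
by rewrite leqNgt; apply/negP => /ltnW/ge_lattice_dist; rewrite leqNgt lt_k.
Qed.

(** The mean value estimate [a^d - b^d <= (a - b) d a^(d-1)], which bounds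
    the number of points of an annulus between two boxes. *)
Lemma expn_sub_bound (a b d : nat) : (b <= a)%N ->
  (a ^ d <= (a - b) * d * a ^ d.-1 + b ^ d)%N.
Proof.
move=> ba; elim: d => [|d IHd]; first by rewrite !expn0 addn1.
have le_d : (b ^ d <= a ^ d)%N by case: (d) => // e; rewrite leq_exp2r.
have -> : ((a - b) * d.+1 * a ^ d =
    a * ((a - b) * d * a ^ d.-1) + (a - b) * a ^ d)%N.
  by case: (d) => [|e] /=; rewrite ?expn0 ?expnS; ring.
have -> : (b ^ d.+1 = a * b ^ d - (a - b) * b ^ d)%N.
  by rewrite expnS -mulnBl subKn.
rewrite expnS /=; nia.
Qed.

Definition box_sum (R : realType) (d : nat) (h : nat -> R) (n : nat)
    (p : 'rV[int]_d) : R :=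
  \sum_(x <- box d n) h (lattice_dist x p).

(** Up to a translation by [- p], the points of the middle box are nested
    between the two centred boxes. *)
Lemma box_sum_sandwich (R : realType) (d : nat) (h : nat -> R)
    (h_ge0 : forall n, 0 <= h n)
    (h_mono : forall m n, (m <= n)%N -> h n <= h m)
    (k m : nat) (p : 'rV[int]_d) :
  in_box m p ->
  box_sum h k (0 : 'rV[int]_d) <= box_sum h (k + m) p
    <= box_sum h (k + m + m) (0 : 'rV[int]_d).
Proof.
move=> p_box; rewrite /box_sum.
pose s := [seq x - p | x <- box d (k + m)].
have -> : \sum_(x <- box d (k + m)) h (lattice_dist x p) =
          \sum_(x <- s) h (lattice_dist x 0).
  by rewrite [RHS]big_map; apply: eq_bigr => x _; rewrite -lattice_dist_sub.
have s_uniq : uniq s by rewrite map_inj_uniq ?box_uniq //; apply: addIr.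
have h_bound (s1 s2 : seq 'rV[int]_d) :
    uniq s1 -> uniq s2 -> {subset s1 <= s2} ->
    \sum_(x <- s1) h (lattice_dist x 0) <= \sum_(x <- s2) h (lattice_dist x 0).
  move=> u1 u2 s12; rewrite -subr_ge0.
  suff /andP[] : 0 <= \sum_(x <- s2) h (lattice_dist x 0) -
       \sum_(x <- s1) h (lattice_dist x 0) <=
       ((size s2)%:R - (size s1)%:R) * h 0%N by [].
  by apply: sum_sub_seq_bound => // x _ _; rewrite h_ge0 h_mono.
apply/andP; split; apply: h_bound; rewrite ?box_uniq // => x.
  move=> /mem_box x_box; apply/mapP; exists (x + p); last by rewrite addrK.
  by apply/mem_box; apply: in_boxD.
move=> /mapP[y /mem_box y_box ->].
by apply/mem_box; apply: in_boxB.
Qed.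

Lemma box_sum_annulus (R : realType) (d : nat) (h : nat -> R)
    (h_ge0 : forall n, 0 <= h n)
    (h_mono : forall m n, (m <= n)%N -> h n <= h m)
    (k m : nat) :
  box_sum h (k + m + m) (0 : 'rV[int]_d) - box_sum h k (0 : 'rV[int]_d) <=
    (4 * m * d * (2 * k + 4 * m + 1) ^ d.-1)%:R * h k.
Proof.
have /andP[_ le_size] :
    0 <= box_sum h (k + m + m) (0 : 'rV[int]_d) -
      box_sum h k (0 : 'rV[int]_d) <=
    ((size (box d (k + m + m)))%:R - (size (box d k))%:R) * h k.
  apply: sum_sub_seq_bound; rewrite ?box_uniq // => x.
    by move=> /mem_box x_box; apply/mem_box => i; have := x_box i; lia.
  by move=> _ /notin_box_dist x_k; rewrite h_ge0 h_mono.
apply: (le_trans le_size); apply: ler_wpM2r => //.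
rewrite !size_box lerBlDr -natrD ler_nat.
set a := (_.*2.+1)%N; set b := (_.*2.+1)%N.
have -> : (2 * k + 4 * m + 1 = a)%N by rewrite /a; lia.
have ba : (b <= a)%N by rewrite /a /b; lia.
have -> : (4 * m = a - b)%N by rewrite /a /b; lia.
exact: expn_sub_bound.
Qed.

(** Moving the centre by a fixed amount changes the sum over a box by at most
    the sum over an annulus of fixed width.  The radius of the box is [k + m]
    so that the inner radius of the annulus is [k]. *)
Lemma box_sum_shift (R : realType) (d : nat) (h : nat -> R)
    (h_ge0 : forall n, 0 <= h n)
    (h_mono : forall m n, (m <= n)%N -> h n <= h m)
    (m : nat) (p : 'rV[int]_d) :
  in_box m p -> exists C : R, forall k, (1 <= k)%N ->
    `|box_sum h (k + m) p - box_sum h (k + m) (0 : 'rV[int]_d)| <=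
    C * (k%:R ^+ (d - 1) * h k).
Proof.
move=> p_box; exists (4 * m * d * (4 * m + 3) ^ d.-1)%:R => k k1.
apply: (@le_trans _ _ (box_sum h (k + m + m) (0 : 'rV[int]_d) -
  box_sum h k (0 : 'rV[int]_d))).
  have /andP[? ?] := box_sum_sandwich h_ge0 h_mono k p_box.
  have /andP[? ?] := box_sum_sandwich h_ge0 h_mono k (@in_box0 d m).
  by rewrite ler_norml; apply/andP; split; lra.
apply: (le_trans (box_sum_annulus d h_ge0 h_mono k m)).
rewrite mulrA; apply: ler_wpM2r => //.
(* As [1 <= k], the side [2 * k + 4 * m + 1] is at most [(4 * m + 3) * k]. *)
rewrite -natrX -natrM ler_nat -[leqRHS]mulnA subn1 -expnMn.
rewrite leq_mul2l; case: d.-1 => [|e]; rewrite ?orbT // leq_exp2r //.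
by apply/orP; right; nia.
Qed.

(** * Decay of the kernel *)

Lemma kernel_small (R : realType) (d : nat) (H : R -> R)
    (Hlim : r ^+ (d - 1) * H r @[r --> +oo] --> (0 : R)) (r eps : R) :
  0 < eps ->
  exists k : nat,
    [/\ (1 <= k)%N, r <= k%:R & `|k%:R ^+ (d - 1) * H k%:R| < eps].
Proof.
move=> eps0.
have Hlim_nat : (fun k : nat => k%:R ^+ (d - 1) * H k%:R) @ \oo --> (0 : R).
  exact: (cvg_comp _ _ (@cvgr_idn R) Hlim).
have [k] : exists k : nat, [/\ (1 <= k)%N, r <= k%:R
    & `|0 - k%:R ^+ (d - 1) * H k%:R| < eps].
  near \oo => k; exists k; split; near: k.
  - exact: nbhs_infty_ge.
  - exact: nbhs_infty_ger.
  - by move/cvgrPdist_lt : Hlim_nat; apply.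
by rewrite sub0r normrN; exists k.
Unshelve. all: by end_near. Qed.

(** A negative value would persist further out, and the weight [r^(d-1)] is at
    least 1 there, which contradicts the decay. *)
Lemma kernel_ge0 (R : realType) (d : nat) (H : R -> R)
    (Hmono : forall r s : R, 0 <= r -> r <= s -> H s <= H r)
    (Hlim : r ^+ (d - 1) * H r @[r --> +oo] --> (0 : R)) (r : R) :
  0 <= r -> 0 <= H r.
Proof.
move=> r0; rewrite leNgt; apply/negP => Hr_lt0.
have [|k [k1 rk]] := kernel_small Hlim r (eps := - H r).
  by rewrite oppr_gt0.
apply/negP; rewrite -leNgt normrM.
have Hk : H k%:R <= H r by apply: Hmono.
rewrite (ler0_norm (le_trans Hk (ltW Hr_lt0))) -[leLHS]mul1r.
have pow_ge1 : 1 <= `|k%:R ^+ (d - 1) : R|.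
  by rewrite normrX exprn_ege1 // normr_nat ler1n.
by apply: ler_pM => //; rewrite ?lerN2 // oppr_ge0 ltW.
Qed.

Lemma kernel_lt_origin (R : realType) (d : nat) (H : R -> R)
    (Hmono : forall r s : R, 0 <= r -> r <= s -> H s <= H r)
    (Hlim : r ^+ (d - 1) * H r @[r --> +oo] --> (0 : R)) :
  (exists r, 0 <= r /\ H r <> 0) ->
  exists m : nat, H m%:R < H 0.
Proof.
move=> [r [r0 /eqP Hr]].
have H0 : 0 < H 0.
  apply: (@lt_le_trans _ _ (H r)); last exact: Hmono.
  by rewrite lt0r Hr (kernel_ge0 Hmono Hlim).
have [k [k1 _ b]] := kernel_small Hlim 0 H0.
exists k; apply: le_lt_trans b; rewrite normrM.
apply: (le_trans (ler_norm _)); rewrite -[leLHS]mul1r ler_wpM2r //.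
by rewrite normrX exprn_ege1 // normr_nat ler1n.
Qed.

(** * The Riesz sum of two peaked plateaus *)

Lemma fin_supp_plateau (R : realType) (d n : nat) (a b : R) (p : 'rV[int]_d) :
  0 <= a -> 0 <= b -> fin_supp_nonneg (plateau n a b p).
Proof.
move=> a0 b0; split=> [x|].
  rewrite /plateau; case: asboolP => // _.
  by case: ifP; rewrite ?addr0 ?addr_ge0.
apply: (@sub_finite_set _ _ [set` box d n]); last exact: finite_seq.
move=> x /=; rewrite /plateau.
case: asboolP => [x_box _|_]; last by rewrite eqxx.
exact/mem_box.
Qed.

Lemma sum_seq_delta (V : nmodType) (T : eqType) (s : seq T) (p : T)
    (F : T -> V) :
  uniq s -> p \in s -> \sum_(y <- s) (if y == p then F y else 0) = F p.
Proof.
move=> s_uniq ps; rewrite (bigD1_seq p) //= eqxx big1 ?addr0 // => y.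
by move=> /negbTE->.
Qed.

(** Expanding [G (u x) (v y)] first in the peak of [v], then in that of [u],
    isolates the terms that depend on the position [p] of the peak of [v]. *)
Lemma riesz_sum_plateau (R : realType) (d n : nat) (G : R -> R -> R)
    (H : R -> R) (s s0 t t0 : R) (p : 'rV[int]_d) :
  0 <= s -> 0 <= t -> 0 <= s0 -> 0 <= t0 ->
  (forall s, 0 <= s -> G s 0 = 0) -> (forall t, 0 <= t -> G 0 t = 0) ->
  in_box n p ->
  riesz_sum G H (plateau n s s0 0) (plateau n t t0 p) =
  \sum_(x <- box d n) \sum_(y <- box d n)
     G (plateau n s s0 0 x) t * H (lattice_dist x y)%:R +
  (G s (t + t0) - G s t) * box_sum (fun k => H k%:R) n p +
  (G (s + s0) (t + t0) - G (s + s0) t - (G s (t + t0) - G s t)) *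
     H (lattice_dist p 0)%:R.
Proof.
move=> s_ge0 t_ge0 s0_ge0 t0_ge0 Gs0 G0t p_box.
have u_ge0 (x : 'rV[int]_d) : 0 <= plateau n s s0 0 x.
  by case: (@fin_supp_plateau R d n s s0 0 s_ge0 s0_ge0) => + _; exact.
have v_ge0 (x : 'rV[int]_d) : 0 <= plateau n t t0 p x.
  by case: (fin_supp_plateau n p t_ge0 t0_ge0) => + _; exact.
have out a b q (x : 'rV[int]_d) :
    x \notin box d n -> plateau n a b q x = 0 :> R.
  by move=> /mem_box x_box; rewrite /plateau asboolF.
rewrite /riesz_sum
  (@fsbigE _ _ _ _ _ [seq (x, y) | x <- box d n, y <- box d n]) //=.
- rewrite (eq_bigl xpredT) => [|q]; last by rewrite in_setT.
  rewrite big_allpairs_dep /=.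
  pose g (x : 'rV[int]_d) :=
    G (plateau n s s0 0 x) (t + t0) - G (plateau n s s0 0 x) t.
  under eq_big_seq => x x_in.
    have -> : \sum_(y <- box d n) G (plateau n s s0 0 x) (plateau n t t0 p y) *
          H (lattice_dist x y)%:R =
        \sum_(y <- box d n) G (plateau n s s0 0 x) t * H (lattice_dist x y)%:R +
        g x * H (lattice_dist x p)%:R.
      pose F y := g x * H (lattice_dist x y)%:R.
      rewrite -[X in _ = _ + X]/(F p) -(@sum_seq_delta _ _ (box d n) p F)
        ?box_uniq //; last exact/mem_box.
      rewrite -big_split /=; apply: eq_big_seq => y /mem_box y_box.
      rewrite {2}/plateau asboolT // /F /g.
      by case: ifP => _; rewrite ?addr0 // mulrBl addrC subrK.
    over.
  rewrite big_split /= -addrA; congr (_ + _).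
  rewrite /box_sum mulr_sumr lattice_distC.
  pose K x := (G (s + s0) (t + t0) - G (s + s0) t - (G s (t + t0) - G s t)) *
     H (lattice_dist x p)%:R.
  rewrite -[X in _ = _ + X]/(K 0).
  rewrite -(@sum_seq_delta _ _ (box d n) 0 K) ?box_uniq //;
    last exact/mem_box/in_box0.
  rewrite -big_split /=; apply: eq_big_seq => x /mem_box x_box.
  rewrite /g /plateau asboolT // /K.
  by case: ifP => _; rewrite ?addr0 //; ring.
- by apply: allpairs_uniq; rewrite ?box_uniq // => -[? ?] [? ?] _ _ [-> ->].
- move=> [x y] _ /= /allpairsPdep xy_notin.
  have [x_in|/out->] := boolP (x \in box d n); last by rewrite G0t // mul0r.
  have [y_in|/out->] := boolP (y \in box d n); last by rewrite Gs0 // mul0r.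
  by case: xy_notin; exists x, y.
Qed.

(** * Supermodularity *)

Theorem proposition5p8 (R : realType) (d : nat) (hd : (1 <= d)%N)
  (es : seq 'rV[rat]_d) (hes : is_enumeration es (@directions d))
  (H : R -> R)
  (Hmono : forall r s : R, 0 <= r -> r <= s -> H s <= H r)
  (Hnz : exists r : R, 0 <= r /\ H r <> 0)
  (Hlim : r ^+ (d - 1) * H r @[r --> +oo] --> (0 : R))
  (G : R -> R -> R)
  (Gmeas : measurable_fun [set p : R * R | 0 <= p.1 /\ 0 <= p.2]
             (fun p : R * R => G p.1 p.2))
  (Gs0 : forall s : R, 0 <= s -> G s 0 = 0)
  (G0t : forall t : R, 0 <= t -> G 0 t = 0)
  (Hriesz : forall u v : 'rV[int]_d -> R,
     fin_supp_nonneg u -> fin_supp_nonneg v ->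
     riesz_sum G H u v <= riesz_sum G H (schwarz es u) (schwarz es v)) :
  supermodular G.
Proof.
move=> s t s0 t0 s_ge0 t_ge0 s0_ge0 t0_ge0.
rewrite -subr_ge0 leNgt; apply/negP => D_lt0.
have [_ esE] := hes.
have es_dir e : e \in es -> directions e by move=> e_in; rewrite -esE.
have es_gt0 : (0 < size es)%N.
  have : [set` es] (delta_mx ord0 (Ordinal hd) : 'rV[rat]_d).
    by rewrite esE; left; exists (Ordinal hd).
  by move=> /=; case: (es).
have [c [z ax]] : exists c z, axis (nth 0 es 0) c z.
  by apply/directions_axis/es_dir/mem_nth.
(* The shift [p] is a multiple of the primitive vector [c] of the first
   direction, large enough for the kernel to have dropped below [H 0]. *)
have [m Hm] := kernel_lt_origin Hmono Hlim Hnz.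
pose p := m%:Z *: c.
have p_box : in_box m p.
  move=> i; rewrite mxE abszM absz_nat -[leqRHS]muln1.
  by rewrite leq_mul2l (axis_le1 ax i) orbT.
have p_dist : H (lattice_dist p 0)%:R < H 0.
  apply: le_lt_trans Hm; apply: Hmono => //; rewrite ler_nat.
  have [i ci] := axis_eq1 ax; apply: (@ge_lattice_dist _ _ _ i).
  by rewrite mxE ci mulr1.
pose h k := H k%:R.
have h_ge0 k : 0 <= h k by apply: kernel_ge0 Hmono Hlim _ _.
have h_mono j k : (j <= k)%N -> h k <= h j.
  by move=> jk; apply: Hmono; rewrite ?ler_nat.
have [C C_bound] := box_sum_shift h_ge0 h_mono p_box.
pose g := G s (t + t0) - G s t.
pose D := G (s + s0) (t + t0) - G (s + s0) t - g.
have {}D_lt0 : D < 0 by apply: le_lt_trans D_lt0; rewrite /D /g; lra.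
pose gap := - D * (H 0 - H (lattice_dist p 0)%:R).
have gap_gt0 : 0 < gap by rewrite mulr_gt0 ?oppr_gt0 // subr_gt0.
(* The summand 1 keeps [A] positive when [g] or [C] vanishes. *)
pose A := `|g| * `|C| + 1.
have A_gt0 : 0 < A by rewrite ltr_wpDl ?mulr_ge0.
have [k [k1 _ k_small]] :=
  kernel_small Hlim 0 (divr_gt0 gap_gt0 A_gt0).
pose n := (k + m)%N.
have n_box : in_box n p.
  by move=> i; apply: (leq_trans (p_box i)); apply: leq_addl.
(* The first test function has its peak at the multiple 0 of [c]. *)
have n_box0 : in_box n (0%Z *: c) by rewrite scale0r; exact: in_box0.
have := Hriesz _ _ (@fin_supp_plateau R d n s s0 0 s_ge0 s0_ge0)
  (fin_supp_plateau n p t_ge0 t0_ge0).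
rewrite (schwarz_plateau t_ge0 t0_ge0 es_gt0 es_dir ax n_box).
have := schwarz_plateau s_ge0 s0_ge0 es_gt0 es_dir ax n_box0.
rewrite scale0r => ->.
rewrite !riesz_sum_plateau //; last exact: in_box0.
have -> : lattice_dist (0 : 'rV[int]_d) 0 = 0%N.
  by apply: big1 => i _; rewrite !mxE.
rewrite -/g -/D -/h => riesz.
have shift_le : `|g * (box_sum h n p - @box_sum R d h n 0)| <=
    A * `|k%:R ^+ (d - 1) * h k|.
  rewrite [leLHS]normrM.
  apply: (@le_trans _ _ (`|g| * (`|C| * `|k%:R ^+ (d - 1) * h k|))).
    apply: ler_wpM2l => //; apply: (le_trans (C_bound k k1)).
    by rewrite -normrM ler_norm.
  by rewrite mulrA ler_wpM2r // /A lerDl.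
have : A * `|k%:R ^+ (d - 1) * h k| < gap by rewrite mulrC -ltr_pdivlMr.
move: shift_le; rewrite ler_norml => /andP[shift_le _].
move=> lt_gap; move: riesz; apply/negP; rewrite -ltNge.
move: shift_le lt_gap; rewrite /gap; lra.
Qed.
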